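(* Let $G$ be a graph, let $k$ be a positive integer, let $D$ be a $k$-optimal set in $G$, and let $X = V(G) - D$. Let $H$ be the bipartite subgraph of $G$ with vertex set $V(G)$, partite sets $D$ and $X$, and edge set consisting of all edges of $G$ having one endpoint in $D$ and the other in $X$. If $J$ is any orientation of the induced subgraph $G[X]$, then $H$ has a $k$-edge-chromatic subgraph $M$ such that $d_M(v) + d^{+}_J(v) \geq k$ for all $v \in X$, where $d^{+}_J(v)$ is the outdegree of $v$ in $J$.
   Context: Graphs are finite and simple. A vertex set $D \subseteq V(G)$ is $k$-dependent if the induced subgraph $G[D]$ has maximum degree at most $k-1$. For a vertex set $D$, $\phi_k(D) = k|D| - |E(G[D])|$. A $k$-optimal set is a $k$-dependent set maximizing $\phi_k$ over all $k$-dependent sets of $G$. A graph is $k$-edge-chromatic if its edges can be properly colored with at most $k$ colors (equivalently, its edge set is a union of $k$ pairwise disjoint matchings). $d_M(v)$ denotes the degree of $v$ in $M$. *)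

(* Defs.v *)
From mathcomp Require Import all_boot all_order all_algebra.

Set Implicit Arguments.
Unset Strict Implicit.
Unset Printing Implicit Defensive.

(* A graph on the finite vertex type T is given by its adjacency relation. *)
Definition simple_graph (T : finType) (e : rel T) : Prop :=
  symmetric e /\ irreflexive e.

Definition subgraph (T : finType) (m e : rel T) : Prop :=
  simple_graph m /\ subrel m e.

Definition degree (T : finType) (e : rel T) (v : T) : nat :=
  #|[set w | e v w]|.

(* Edges as unordered pairs: each edge is counted once. *)
Definition edges (T : finType) (e : rel T) : {set {set T}} :=
  [set [set xy.1; xy.2] | xy : T * T & e xy.1 xy.2].

(* G[D], kept on the vertex type T: vertices outside D become isolated, which
   changes neither the edge set nor the degrees of vertices of D. *)
Definition induced (T : finType) (e : rel T) (D : {set T}) : rel T :=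
  [rel x y | [&& x \in D, y \in D & e x y]].

Definition bipartite_between (T : finType) (e : rel T) (D X : {set T}) : rel T :=
  [rel x y | e x y && ((x \in D) && (y \in X) || (x \in X) && (y \in D))].

Definition k_dependent (T : finType) (e : rel T) (k : nat) (D : {set T}) : Prop :=
  \max_(v in D) degree (induced e D) v <= k - 1.

Definition phi (T : finType) (e : rel T) (k : nat) (D : {set T}) : int :=
  (k%:Z * #|D|%:Z - #|edges (induced e D)|%:Z)%R.

Definition k_optimal (T : finType) (e : rel T) (k : nat) (D : {set T}) : Prop :=
  k_dependent e k D /\
  forall D' : {set T}, k_dependent e k D' -> (phi e k D' <= phi e k D)%R.

Definition k_edge_chromatic (T : finType) (e : rel T) (k : nat) : Prop :=
  exists c : {set T} -> nat,
    (forall A, A \in edges e -> c A < k) /\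
    (forall A B, A \in edges e -> B \in edges e ->
       A != B -> A :&: B != set0 -> c A != c B).

(* J x y means that the edge xy is directed from x to y. *)
Definition orientation (T : finType) (J e : rel T) : Prop :=
  (forall x y, e x y = J x y || J y x) /\
  (forall x y, ~~ (J x y && J y x)).

Definition outdegree (T : finType) (J : rel T) (v : T) : nat :=
  #|[set w | J v w]|.

(* Main.v *)
Require Import Defs.
From mathcomp Require Import all_boot all_order all_algebra perm zify.

(* Deleting a vertex of degree at least k does not decrease phi_k, so the
   k-optimal set D maximizes phi_k over all vertex sets.  The degrees
   f(v) = max(0, k - d+_J(v)) on X, with degrees at most k on D, can be realized
   in H iff f(S) <= k|U| + e_H(S, D - U) for all S and U; a pair (S, U)
   violating this, with S restricted to the vertices with f > 0, would give
   phi_k((D - U) + S) > phi_k(D), because e(G[S]) is at most the sum of the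
   J-outdegrees over S.  The resulting bipartite graph has maximum degree at
   most k and is k-edge-colourable by Konig's theorem. *)

Set Implicit Arguments.
Unset Strict Implicit.
Unset Printing Implicit Defensive.

(** * Degree-constrained subgraphs of bipartite graphs *)

Section Bipartite.
Variables A B : finType.
Implicit Types (E : {set A * B}) (S : {set A}) (U : {set B}).

Definition ldeg E a := #|[set b | (a, b) \in E]|.
Definition rdeg E b := #|[set a | (a, b) \in E]|.

Lemma ldegE E a : ldeg E a = #|[set p in E | p.1 == a]|.
Proof.
rewrite /ldeg -(card_imset _ (_ : injective (pair a))); last by move=> ? ? [].
apply: eq_card => -[a' b]; rewrite inE /=.
apply/imsetP/andP => [[b' + [-> ->]]|[abE /eqP aa]]; first by rewrite inE eqxx.
by exists b; rewrite ?inE -?aa.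
Qed.

Lemma rdegE E b : rdeg E b = #|[set p in E | p.2 == b]|.
Proof.
rewrite /rdeg -(card_imset _ (_ : injective (pair^~ b))); last by move=> ? ? [].
apply: eq_card => -[a b']; rewrite inE /=.
apply/imsetP/andP => [[a' + [-> ->]]|[abE /eqP bb]]; first by rewrite inE eqxx.
by exists a; rewrite ?inE -?bb.
Qed.

Definition cut E S U := #|[set p in E | (p.1 \in S) && (p.2 \notin U)]|.

Lemma cutE E S U :
  cut E S U = \sum_(p in E) ((p.1 \in S) && (p.2 \notin U) : nat).
Proof.
rewrite /cut -sum1_card big_mkcond [RHS]big_mkcond /=.
by apply: eq_bigr => p _; rewrite inE; case: (p \in E) => //=; case: (_ && _).
Qed.

(** The inequality holds edge by edge, which leaves a finite check on four memberships. *)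
Lemma cut_submodular E S1 S2 U1 U2 :
  cut E (S1 :|: S2) (U1 :|: U2) + cut E (S1 :&: S2) (U1 :&: U2)
    <= cut E S1 U1 + cut E S2 U2.
Proof.
rewrite !cutE -!big_split /=; apply: leq_sum => p _; rewrite !inE.
by do 4!case: (_ \in _).
Qed.

Lemma sum_setUI (f : A -> nat) S1 S2 :
  \sum_(a in S1 :|: S2) f a + \sum_(a in S1 :&: S2) f a
    = \sum_(a in S1) f a + \sum_(a in S2) f a.
Proof.
rewrite 4!(big_mkcond (fun a => a \in _)) -!big_split /=.
apply: eq_bigr => a _; rewrite !inE.
by do 2!case: (_ \in _); rewrite ?addn0 ?add0n.
Qed.

Lemma cutD1 E S U a b :
  (a, b) \in E ->
  cut E S U = ((a \in S) && (b \notin U)) + cut (E :\ (a, b)) S U.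
Proof.
move=> abE; rewrite !cutE (big_setD1 _ abE) /=; congr (_ + _).
Qed.

(** Since [S] contains every neighbour of [b], all edges at [b] are cut, and they are exactly the
    ones lost when [b] joins [U]. *)
Lemma cutU1r E S U b :
  b \notin U -> {subset [set a | (a, b) \in E] <= S} ->
  cut E S U = rdeg E b + cut E S (b |: U).
Proof.
move=> bU sbS; rewrite {1}/cut -(cardsID [set p | p.2 == b]).
congr (_ + _); last first.
  rewrite /cut; apply: eq_card => p; rewrite !inE negb_or.
  by case: (p.2 == b); rewrite ?andbF ?andbT.
rewrite rdegE; apply: eq_card => -[a b']; rewrite !inE /=.
case: eqVneq => [->|_]; rewrite ?andbF // !andbT bU andbT.
by case: (boolP (_ \in E)) => //= aE; rewrite sbS // inE.
Qed.

(** Min-cut condition for the network with capacity [f a] into each [a], 1 along [E], and [k] out of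
    each right vertex: the cut given by [(S, U)] has capacity f(A - S) + k|U| + [cut E S U], and a
    flow of value f(A) needs this to be at least f(A). *)
Definition hall (f : A -> nat) k E :=
  [forall S : {set A}, forall U : {set B},
    \sum_(a in S) f a <= k * #|U| + cut E S U].

Lemma hallP f k E :
  reflect (forall S U, \sum_(a in S) f a <= k * #|U| + cut E S U) (hall f k E).
Proof.
apply: (iffP forallP) => [h S U|h S]; first by move/forallP: (h S).
by apply/forallP.
Qed.

Lemma hall_ldeg f k E a : hall f k E -> f a <= ldeg E a.
Proof.
move/hallP/(_ [set a] set0); rewrite big_set1 cards0 muln0 => /leq_trans -> //.
rewrite add0n ldegE /cut; apply/subset_leq_card/subsetP => p.
by rewrite !inE andbT.
Qed.

(* Tight pairs are stable under union, by submodularity. *)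
Lemma tightU f k E S1 S2 U1 U2 :
  hall f k E ->
  k * #|U1| + cut E S1 U1 <= \sum_(a in S1) f a ->
  k * #|U2| + cut E S2 U2 <= \sum_(a in S2) f a ->
  k * #|U1 :|: U2| + cut E (S1 :|: S2) (U1 :|: U2)
    <= \sum_(a in S1 :|: S2) f a.
Proof.
move=> /hallP/(_ (S1 :&: S2) (U1 :&: U2)) h t1 t2.
have := cut_submodular E S1 S2 U1 U2.
have := sum_setUI f S1 S2.
have : k * #|U1 :|: U2| + k * #|U1 :&: U2| = k * #|U1| + k * #|U2|.
  by rewrite -!mulnDr cardsUI.
lia.
Qed.

(* Every edge of a minimal [E] is cut by a tight pair.  For the edges at [b], the
   union [(S, U)] of these pairs is tight and [S] contains all neighbours of [b],
   so moving [b] into [U] would violate [hall] if [b] had degree above [k]. *)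
Lemma minimal_hall_rdeg f k E b :
  minset (hall f k) E -> rdeg E b <= k.
Proof.
move=> /minsetP[hE minE]; rewrite leqNgt; apply/negP => degb.
pose tight (p : {set A} * {set B}) :=
  (b \notin p.2) && (k * #|p.2| + cut E p.1 p.2 <= \sum_(a in p.1) f a).
have t0 : tight (set0, set0).
  rewrite /tight /= inE cards0 muln0 cutE big1 // => p _.
  by rewrite inE.
(* A tight pair with the largest [S] serves as the union: joining it with another tight pair that
   cuts an edge at a missed neighbour of [b] would enlarge [S]. *)
case: (arg_maxnP (fun p : {set A} * {set B} => #|p.1|) t0) => -[S U].
move=> /= /andP[/= bU tSU] maxS.
have sNS : {subset [set a | (a, b) \in E] <= S}.
  move=> a; rewrite inE => abE; apply/negPn/negP => aS.
  have nh : ~~ hall f k (E :\ (a, b)).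
    apply/negP => /minE /(_ (subD1set _ _)) eqE.
    by move: abE; rewrite -eqE !inE eqxx.
  move: nh; rewrite negb_forall => /existsP[S'].
  rewrite negb_forall => /existsP[U']; rewrite -ltnNge => lt'.
  have /hallP/(_ S' U') := hE; rewrite (cutD1 S' U' abE).
  (* Deleting one edge lowers a cut by at most 1, so the pair that becomes violating must cut
     [(a, b)] and be tight for [E]. *)
  case: (boolP (_ && _)) => [/andP[aS' bU'] _|_]; last by lia.
  have t' : k * #|U'| + cut E S' U' <= \sum_(a in S') f a.
    by rewrite (cutD1 S' U' abE) aS' bU' /=; lia.
  have tU : tight (S :|: S', U :|: U').
    by rewrite /tight /= inE negb_or bU bU' tightU.
  have := maxS _ tU; rewrite /= leqNgt => /negP; apply.
  apply: proper_card; apply/properP; split; first exact: subsetUl.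
  by exists a; rewrite ?inE ?aS' ?orbT.
have /hallP/(_ S (b |: U)) := hE.
rewrite cardsU1 bU; move: tSU; rewrite (cutU1r bU sNS) mulnDr.
by rewrite muln1; lia.
Qed.

Lemma ldegD1 E a b a' :
  (a, b) \in E -> ldeg E a' = (a' == a) + ldeg (E :\ (a, b)) a'.
Proof.
move=> abE; rewrite /ldeg; have [->{a'}|ne] := eqVneq a' a.
  rewrite (cardsD1 b) inE abE; congr (_ + _); apply: eq_card => b'.
  by rewrite !inE xpair_eqE eqxx.
by apply: eq_card => b'; rewrite !inE xpair_eqE (negPf ne).
Qed.

(** Two successive minimal choices: minimality for [hall] bounds the right degrees by [k] and keeps
    left degrees at least [f]; minimality for the latter property alone then makes them equal to
    [f], as a surplus edge could be deleted. *)
Lemma degree_constrained_subgraph (f : A -> nat) k E :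
  hall f k E ->
  exists2 E' : {set A * B}, E' \subset E
    & (forall a, ldeg E' a = f a) /\ (forall b, rdeg E' b <= k).
Proof.
move=> /minset_exists[E1 /[dup] /minsetp h1 /minimal_hall_rdeg r1 s1].
pose P (E' : {set A * B}) := [forall a, f a <= ldeg E' a].
have /minset_exists[E2 /minsetP[/forallP h2 min2] s2] : P E1.
  by apply/forallP => a; apply: hall_ldeg h1.
exists E2; first exact: subset_trans s2 s1.
split=> [a|b]; last first.
  apply: leq_trans (r1 b); apply/subset_leq_card/subsetP => a.
  by rewrite !inE; apply/subsetP.
apply/eqP; rewrite eqn_leq h2 andbT leqNgt; apply/negP => lta.
have /card_gt0P[b] : 0 < ldeg E2 a by apply: leq_ltn_trans lta.
rewrite inE => abE.
suff /min2 /(_ (subD1set _ _)) eqE : P (E2 :\ (a, b)).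
  by move: abE; rewrite -eqE !inE eqxx.
apply/forallP => a'; have := h2 a'; rewrite (ldegD1 a' abE).
by case: eqVneq => [->|//]; move: lta; rewrite (ldegD1 a abE) eqxx; lia.
Qed.

(** * Edge colouring of bipartite graphs *)

Definition proper_colouring (C : eqType) E (c : A * B -> C) :=
  (forall a b b', (a, b) \in E -> (a, b') \in E -> c (a, b) = c (a, b') -> b = b')
  /\ (forall a a' b, (a, b) \in E -> (a', b) \in E -> c (a, b) = c (a', b) -> a = a').

(* Interchanging [al] and [be] along the alternating path that leaves [x]
   through a [be]-edge frees [be] at [x]; the path enters right vertices
   through [be]-edges only, hence avoids [y]. *)
Lemma kempe_swap (C : finType) E (c : A * B -> C) x y (al be : C) :
  proper_colouring E c ->
  (forall b, (x, b) \in E -> c (x, b) != al) ->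
  (forall a, (a, y) \in E -> c (a, y) != be) ->
  exists c' : A * B -> C, [/\ proper_colouring E c',
    forall b, (x, b) \in E -> c' (x, b) != be
    & forall a, (a, y) \in E -> c' (a, y) != be].
Proof.
move=> [pl pr] xal ybe.
(* One step of [r] is two edges of the alternating path: a [be]-edge to the right, then an [al]-edge
   back. *)
pose r := [rel a a' | [exists b, [&& (a, b) \in E, (a', b) \in E,
   c (a, b) == be & c (a', b) == al]]].
(* As [al] is missing at [x], an [al]-edge at a reachable vertex is the one by which the path
   arrived, so its right end also has a [be]-edge from a reachable vertex. *)
have predC a b : connect r x a -> (a, b) \in E -> c (a, b) = al ->
    exists a0, [/\ connect r x a0, (a0, b) \in E & c (a0, b) = be].
  move=> /connectP[p]; case: (lastP p) => [|q z] /=.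
    by move=> _ -> /xal/eqP.
  rewrite last_rcons rcons_path => /andP[pq /existsP[b' /and4P[aE zE /eqP cbe /eqP cal]]] ->.
  move=> zbE czb; have eb : b = b' by apply: pl zbE zE _; rewrite czb.
  exists (last x q); rewrite eb; split=> //.
  by apply/connectP; exists q.
(* The left end alone decides the recolouring; [mixed] excludes conflicts at right vertices between
   swapped and unswapped edges. *)
pose c' p := if connect r x p.1 then tperm al be (c p) else c p.
have mixed a1 a2 b : (a1, b) \in E -> (a2, b) \in E -> connect r x a1 ->
    ~~ connect r x a2 -> tperm al be (c (a1, b)) != c (a2, b).
  move=> e1 e2 r1 r2; case: tpermP => [c1|c1|_ _].
  - apply/eqP => c2; have [a0 [r0 e0 c0]] := predC _ _ r1 e1 c1.
    by move: r2; rewrite -(pr a0 a2 b e0 e2) ?r0 // c0.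
  - apply/eqP => c2; move/negP: r2; apply; apply: connect_trans r1 (connect1 _).
    by apply/existsP; exists b; rewrite e1 e2 c1 -c2 !eqxx.
  - apply/eqP => /(pr _ _ _ e1 e2) a12.
    by move: r2; rewrite -a12 r1.
exists c'; split.
- split=> [a b b' ab ab'|a a' b ab a'b].
    rewrite /c' /=; case: ifP => _; last exact: pl.
    by move/perm_inj; apply: pl.
  rewrite /c' /=; case: ifPn => ra; case: ifPn => ra'.
  + by move/perm_inj; apply: pr.
  + by move/eqP; rewrite (negPf (mixed _ _ _ ab a'b ra ra')).
  + by move/esym/eqP; rewrite (negPf (mixed _ _ _ a'b ab ra' ra)).
  + exact: pr.
- move=> b xb; rewrite /c' /= connect0.
  by case: tpermP (xal _ xb) => [->|->|_ /eqP //]; rewrite ?eqxx 1?eq_sym.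
- move=> a ay; rewrite /c' /=; case: ifP => ra; last exact: ybe.
  case: tpermP => [ca | ca | _ /eqP //].
  + have [a0 [_ e0 c0]] := predC _ _ ra ay ca.
    by have := ybe _ e0; rewrite c0 eqxx.
  + by have := ybe _ ay; rewrite ca eqxx.
Qed.

Lemma missing_colour (I : finType) k (N : {set I}) (g : I -> 'I_k) :
  #|N| < k -> exists al, forall i, i \in N -> g i != al.
Proof.
move=> ltN; have : ~~ ([set: 'I_k] \subset g @: N).
  apply/negP => /subset_leq_card; rewrite cardsT card_ord leqNgt => /negP; apply.
  exact: leq_ltn_trans (leq_imset_card _ _) ltN.
case/subsetPn => al _ alN; exists al => i iN; apply: contraNneq alN => <-.
exact: imset_f.
Qed.

(** Induction on the number of edges: after removing [(x, y)], some [al] is missing at [x] and some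
    [be] at [y]; a Kempe swap frees [be] at both ends. Writing the bound as [k.+1] provides a colour
    for the arbitrary values off [E]. *)
Lemma konig_edge_colouring k E :
  (forall a, ldeg E a <= k.+1) -> (forall b, rdeg E b <= k.+1) ->
  exists c : A * B -> 'I_k.+1, proper_colouring E c.
Proof.
elim: {E}#|E| {-2}E (erefl #|E|) => [|n IHn] E.
  by move/eqP; rewrite cards_eq0 => /eqP -> _ _; exists (fun=> ord0); split=> ? ? ?; rewrite inE.
move=> cE dl dr; have /card_gt0P[[x y] xyE] : 0 < #|E| by rewrite cE.
set E1 := E :\ (x, y).
have s1 : E1 \subset E by apply: subD1set.
have cE1 : #|E1| = n by move: cE; rewrite (cardsD1 (x, y)) xyE => -[].
have [||c pc] := IHn E1 cE1.
- move=> a; apply: leq_trans (dl a); apply/subset_leq_card/subsetP => b.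
  by rewrite inE => /(subsetP s1); rewrite inE.
- move=> b; apply: leq_trans (dr b); apply/subset_leq_card/subsetP => a.
  by rewrite inE => /(subsetP s1); rewrite inE.
have ltx : #|[set b | (x, b) \in E1]| < k.+1.
  apply: leq_trans (dl x); apply: proper_card; apply/properP; split.
    by apply/subsetP => b; rewrite inE => /(subsetP s1); rewrite inE.
  by exists y; rewrite !inE ?eqxx.
have lty : #|[set a | (a, y) \in E1]| < k.+1.
  apply: leq_trans (dr y); apply: proper_card; apply/properP; split.
    by apply/subsetP => a; rewrite inE => /(subsetP s1); rewrite inE.
  by exists x; rewrite !inE ?eqxx.
have [al xal] := missing_colour (fun b => c (x, b)) ltx.
have [be ybe] := missing_colour (fun a => c (a, y)) lty.
have [|| c' [[pl pr] xc yc]] := @kempe_swap _ E1 c x y al be pc.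
- by move=> b h; apply: xal; rewrite inE.
- by move=> a h; apply: ybe; rewrite inE.
have inE1 p : p \in E -> p != (x, y) -> p \in E1 by rewrite !inE => -> ->.
exists (fun p => if p == (x, y) then be else c' p).
split=> [a b b' ab ab'|a a' b ab a'b].
  case: eqVneq => [[ax bx]|n1]; case: eqVneq => [[ax' bx']|n2].
  - by rewrite bx bx'.
  - move: ab' n2; rewrite ax => ab' n2 h.
    by have := xc _ (inE1 _ ab' n2); rewrite -h eqxx.
  - move: ab n1; rewrite ax' => ab n1 h.
    by have := xc _ (inE1 _ ab n1); rewrite h eqxx.
  - by apply: pl; apply: inE1.
case: eqVneq => [[ax bx]|n1]; case: eqVneq => [[ax' bx']|n2].
- by rewrite ax ax'.
- move: a'b n2; rewrite bx => a'b n2 h.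
  by have := yc _ (inE1 _ a'b n2); rewrite -h eqxx.
- move: ab n1; rewrite bx' => ab n1 h.
  by have := yc _ (inE1 _ ab n1); rewrite h eqxx.
- by apply: pr; apply: inE1.
Qed.

End Bipartite.

(** * Edge counts and the maximality of [phi] *)

Section KOptimal.
Variables (T : finType) (e : rel T) (k : nat).
Hypotheses (he : simple_graph e) (hk : 0 < k).
Implicit Types D : {set T}.

Lemma edgesP (r : rel T) (A : {set T}) :
  reflect (exists x y, r x y /\ A = [set x; y]) (A \in edges r).
Proof.
apply: (iffP imsetP) => [[[x y]]|[x [y [rxy ->]]]]; last by exists (x, y); rewrite ?inE.
by rewrite inE /= => rxy ->; exists x, y.
Qed.

Lemma edges_inducedS D1 D2 :
  D1 \subset D2 -> edges (induced e D1) \subset edges (induced e D2).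
Proof.
move=> /subsetP s12; apply/subsetP => A /edgesP[x [y [/and3P[x1 y1 exy] ->]]].
by apply/edgesP; exists x, y; split=> //; apply/and3P; split=> //; apply: s12.
Qed.

Lemma phi_leE D1 D2 :
  (phi e k D1 <= phi e k D2)%R =
  (k * #|D1| + #|edges (induced e D2)| <= k * #|D2| + #|edges (induced e D1)|).
Proof. by rewrite /phi -!PoszM; lia. Qed.

(** The pairs [[set v; w]] with [w] a neighbour of [v] are distinct, because [v != w], and none of
    them lies inside [D :\ v]. *)
Lemma edges_inducedD1 D v :
  v \in D ->
  degree (induced e D) v + #|edges (induced e (D :\ v))|
    <= #|edges (induced e D)|.
Proof.
move=> vD; have [e_sym e_irr] := he.
set N := [set w | induced e D v w].
have vN w : w \in N -> v != w.
  by rewrite inE => /and3P[_ _]; apply: contraTneq => <-; rewrite e_irr.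
have inj : {in N &, injective (fun w => [set v; w])}.
  move=> w w' wN w'N /setP/(_ w); rewrite !inE eqxx orbT => /esym/orP[|/eqP//].
  by rewrite eq_sym (negPf (vN _ wN)).
rewrite -[degree _ _](card_in_imset inj) -cardsUI.
rewrite (_ : _ :&: _ = set0) ?cards0 ?addn0; last first.
  apply/setP => A; rewrite !inE; apply/andP => -[/imsetP[w wN ->]].
  case/edgesP => x [y [/and3P[xD yD _]]] /setP/(_ v); rewrite !inE eqxx /=.
  by move: xD yD; rewrite !inE 2![v == _]eq_sym => /andP[/negPf-> _] /andP[/negPf-> _].
apply: subset_leq_card; rewrite subUset edges_inducedS ?subD1set // andbT.
apply/subsetP => A /imsetP[w]; rewrite inE => vw ->.
by apply/edgesP; exists v, w.
Qed.

(* Deleting a vertex of degree at least [k] does not decrease [phi], so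
   [k]-dependence may be dropped in the maximality of a [k]-optimal set. *)
Lemma k_optimal_max D D' :
  k_optimal e k D -> (phi e k D' <= phi e k D)%R.
Proof.
move=> [_ maxD]; elim: {D'}#|D'| {-2}D' (leqnn #|D'|) => [|n IHn] D' leD'.
  apply: maxD; rewrite /k_dependent big1 // => v.
  by move: leD'; rewrite leqn0 cards_eq0 => /eqP ->; rewrite inE.
case: (leqP (\max_(v in D') degree (induced e D') v) (k - 1)) => [/maxD //|].
rewrite ltnNge => /bigmax_leqP big.
have /existsP[v /andP[vD' dv]] : [exists v, (v \in D') && (k <= degree (induced e D') v)].
  apply: contra_notT big; rewrite negb_exists => /forallP h v vD'.
  by move: (h v); rewrite vD' /=; lia.
have := IHn (D' :\ v); move: leD'; rewrite (cardsD1 v) vD' add1n ltnS => l /(_ l).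
apply: Order.POrderTheory.le_trans.
by rewrite phi_leE (cardsD1 v D') vD'; have := edges_inducedD1 vD'; lia.
Qed.

(** Arcs are counted by their tails; forgetting directions can only merge them. *)
Lemma card_out_edges (J : rel T) (S : {set T}) :
  #|[set [set p.1; p.2] | p : T * T & (p.1 \in S) && J p.1 p.2]|
    <= \sum_(x in S) outdegree J x.
Proof.
apply: leq_trans (leq_imset_card _ _) _.
rewrite -sum1_card (eq_bigl (fun p : T * T => (p.1 \in S) && J p.1 p.2)).
  rewrite -(pair_big_dep (mem S) J (fun _ _ => 1)) /=.
  by apply: leq_sum => x _; rewrite /outdegree -sum1_card; apply: eq_leq; apply: eq_bigl => y; rewrite inE.
by move=> p; rewrite inE.
Qed.

(** Both sides of the bipartite graph are [T], with edges directed from outside [D] into [D].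
    Comparing [phi] at [D] and at [D'] gives k|S'| <= k|U| + [cut E S U] + (outdegrees over [S']),
    which is the claim by [fS]. *)
Lemma k_optimal_hall D (J : rel T) :
  k_optimal e k D -> orientation J (induced e (~: D)) ->
  hall (fun x => if x \in D then 0 else k - outdegree J x) k
    [set p : T * T | [&& e p.1 p.2, p.1 \notin D & p.2 \in D]].
Proof.
move=> optD [hJ _]; have [e_sym _] := he; apply/hallP => S U; set E := [set p | _].
pose f x := if x \in D then 0 else k - outdegree J x; rewrite -[X in X <= _]/(\sum_(x in S) f x).
pose S' := [set x in S | (x \notin D) && (outdegree J x < k)].
pose D' := (D :\: U) :|: S'.
have dis : (D :\: U) :&: S' = set0.
  by apply/setP => x; rewrite !inE; case: (x \in D); rewrite ?andbF.
have cardD' : #|D'| = #|D :\: U| + #|S'| by rewrite -cardsUI dis cards0 addn0.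
have cardD : #|D :\: U| + #|U| >= #|D|.
  by rewrite -(cardsID U D) addnC leq_add2l subset_leq_card ?subsetIr.
(* Outside [S'] the demand [f] vanishes: by definition on [D], and by truncated subtraction where
   the outdegree is at least [k]. *)
have fS : \sum_(x in S) f x + \sum_(x in S') outdegree J x = k * #|S'|.
  rewrite (bigID (mem S')) /= [X in _ + X + _]big1 => [|x].
    rewrite addn0 (eq_bigl (mem S')) => [|x]; last by rewrite !inE; case: (x \in S).
    rewrite -big_split mulnC -sum_nat_const; apply: eq_bigr => x /=.
    rewrite inE /f => /and3P[_ /negPf -> lt]; lia.
  by rewrite inE /f => /andP[-> /=]; case: (x \in D) => //=; lia.
have edgesD' : #|edges (induced e D')| <=
    #|edges (induced e D)| + cut E S U + \sum_(x in S') outdegree J x.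
  pose C := [set [set p.1; p.2] | p in [set p in E | (p.1 \in S) && (p.2 \notin U)]].
  pose O := [set [set p.1; p.2] | p : T * T & (p.1 \in S') && J p.1 p.2].
  (* An edge inside [D'] lies in [D :\: U], or joins it to [S'] and is cut, or lies in [S'] and is
     an arc of [J] with its tail there. *)
  have sub : edges (induced e D') \subset edges (induced e D) :|: C :|: O.
    apply/subsetP => A /edgesP[x [y [/and3P[xD' yD' exy] ->]]].
    have cross u v : e u v -> u \in S' -> v \in D :\: U ->
        [set u; v] \in edges (induced e D) :|: C :|: O.
      rewrite !inE => euv /and3P[uS uD _] /andP[vU vD].
      apply/orP; left; apply/orP; right; apply/imsetP; exists (u, v) => //.
      by rewrite !inE /= euv uD vD uS vU.
    move: xD' yD'; rewrite !(in_setU _ (D :\: U)).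
    case/orP => xS; case/orP => yS.
    - rewrite !in_setU; apply/orP; left; apply/orP; left; apply/edgesP.
      exists x, y; split=> //; apply/and3P; split=> //.
        by move: xS; rewrite inE => /andP[].
      by move: yS; rewrite inE => /andP[].
    - by rewrite setUC; apply: cross; rewrite // e_sym.
    - exact: cross.
    - rewrite in_setU; apply/orP; right; apply/imsetP.
      have : induced e (~: D) x y.
        move: xS yS; rewrite !inE => /and3P[_ xD _] /and3P[_ yD _].
        by apply/and3P; rewrite !inE.
      rewrite hJ => /orP[Jxy|Jyx]; first by exists (x, y); rewrite //= inE /= xS.
      by exists (y, x); rewrite 1?setUC //= inE /= yS.
  apply: leq_trans (subset_leq_card sub) _.
  apply: leq_trans (leq_card_setU _ _) _; apply: leq_add (card_out_edges _ _).
  apply: leq_trans (leq_card_setU _ _) _; rewrite leq_add2l.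
  exact: leq_imset_card.
have := k_optimal_max D' optD; rewrite phi_leE cardD'; nia.
Qed.

End KOptimal.

(** * Assembly of the subgraph and its colouring *)

Theorem theorem1p4 (T : finType) (e : rel T) (he : simple_graph e)
    (k : nat) (hk : 0 < k) (D : {set T}) (hD : k_optimal e k D)
    (X : {set T}) (hX : X = ~: D)
    (J : rel T) (hJ : orientation J (induced e X)) :
  exists M : rel T,
    [/\ subgraph M (bipartite_between e D X),
        k_edge_chromatic M k
      & forall v, v \in X -> k <= degree M v + outdegree J v].
Proof.
subst X; have [e_sym e_irr] := he.
have [E sE [dl dr]] := degree_constrained_subgraph (k_optimal_hall he hk hD hJ).
have EP x y : (x, y) \in E -> [/\ e x y, x \notin D & y \in D].
  by move/(subsetP sE); rewrite inE => /and3P[].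
pose M := [rel x y | ((x, y) \in E) || ((y, x) \in E)].
have [c [pl pr]] : exists c : T * T -> 'I_k, proper_colouring E c.
  rewrite -(prednK hk); apply: konig_edge_colouring => x; rewrite prednK //.
  by rewrite dl; case: ifP => // _; apply: leq_subr.
have orient A : A \in edges M -> exists2 p, p \in E & A = [set p.1; p.2].
  move=> /edgesP[x [y [/orP[xyE|yxE] ->]]]; first by exists (x, y).
  by exists (y, x); rewrite // setUC.
exists M; split.
- split; first split.
  + by move=> x y; rewrite /= orbC.
  + by move=> x; rewrite /= orbb; apply/negP => /EP[]; rewrite e_irr.
  + move=> x y /orP[] /EP[exy xD yD]; rewrite /bipartite_between /= !inE ?exy ?xD ?yD ?orbT //.
    by rewrite e_sym exy.
(* An edge of [M] has exactly one end in [D], so it determines its pair in [E]; the default 0 is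
   never taken on edges of [M]. *)
- pose col (A : {set T}) : nat :=
    if [pick p in E | A == [set p.1; p.2]] is Some p then c p else 0.
  have colE p : p \in E -> col [set p.1; p.2] = c p.
    move=> pE; rewrite /col; case: pickP => [q /andP[qE /eqP eq]|/(_ p)]; last by rewrite pE eqxx.
    suff -> : p = q by [].
    case: p q pE qE eq => [x y] [x' y'] /= /EP[_ xD yD] /EP[_ xD' yD'] /setP h.
    have := h x; rewrite !inE eqxx => /esym/orP[/eqP <-|/eqP xy']; last by rewrite xy' yD' in xD.
    have := h y; rewrite !inE eqxx orbT => /esym/orP[/eqP yx'|/eqP <- //].
    by rewrite yx' (negPf xD') in yD.
  exists col; split=> [A /orient[p pE ->]|A B /orient[p pE ->] /orient[q qE ->]].
    by rewrite colE.
  rewrite !colE // => npq meet; apply: contra_neq npq => /val_inj cpq.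
  suff -> : p = q by [].
  case: p q pE qE cpq meet => [x y] [x' y'] /= pE qE cpq.
  have [_ xD yD] := EP _ _ pE; have [_ xD' yD'] := EP _ _ qE.
  (* Left ends avoid [D] and right ends lie in [D], so a shared vertex is a left end of both edges
     or a right end of both. *)
  case/set0Pn => z; rewrite !inE => /andP[/orP[]/eqP -> /orP[]/eqP h].
  + by subst x'; rewrite (pl _ _ _ pE qE cpq).
  + by rewrite h yD' in xD.
  + by rewrite h (negPf xD') in yD.
  + by subst y'; rewrite (pr _ _ _ pE qE cpq).
- move=> v; rewrite inE => vD; have := dl v; rewrite (negPf vD) => dv.
  have : ldeg E v <= degree M v.
    by apply/subset_leq_card/subsetP => w; rewrite !inE /= => ->.
  by lia.
Qed.
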